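(* Let $X$ be a reflexive (real or complex) Banach space. Then $\eta_{\mathrm{nu}}(X)(\varepsilon)=\eta_{\mathrm{nu}}(X^* )(\varepsilon)$ for every $\varepsilon\in(0,1)$. In particular, $X$ has the BPBp-nu if and only if $X^*$ has the BPBp-nu.
   Context: For a real or complex Banach space $X$ with dual $X^*$ and unit sphere $S_X$, $\mathcal{L}(X)$ is the space of bounded linear operators on $X$ with the operator norm, $\Pi(X)=\{(x,x^* )\in S_X\times S_{X^*} : x^*(x)=1\}$, and the numerical radius of $T\in\mathcal{L}(X)$ is $v(T)=\sup\{|x^*(Tx)| : (x,x^* )\in\Pi(X)\}$. BPBp-nu (Bishop-Phelps-Bollobás property for numerical radius): for every $0<\varepsilon<1$ there exists $\eta(\varepsilon)>0$ such that whenever $T\in\mathcal{L}(X)$ and $(x,x^* )\in\Pi(X)$ satisfy $v(T)=1$ and $|x^*(Tx)|>1-\eta(\varepsilon)$, there exist $S\in\mathcal{L}(X)$ and $(y,y^* )\in\Pi(X)$ with $v(S)=|y^*(Sy)|=1$, $\|T-S\|<\varepsilon$, $\|x-y\|<\varepsilon$ and $\|x^*-y^*\|<\varepsilon$. Modulus: let $\Pi_{\mathrm{nu}}(X)=\{(x,x^*,T) : (x,x^* )\in\Pi(X),\ T\in\mathcal{L}(X),\ v(T)=1=|x^*(Tx)|\}$, and let $\mathrm{dist}((x,x^*,T),(y,y^*,S))=\max\{\|x-y\|,\|x^*-y^*\|,\|T-S\|\}$ on $S_X\times S_{X^*}\times\mathcal{L}(X)$. For $\varepsilon\in(0,1)$,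 $$\eta_{\mathrm{nu}}(X)(\varepsilon)=\inf\{1-|x^*(Tx)| : (x,x^* )\in\Pi(X),\ T\in\mathcal{L}(X),\ v(T)=1,\ \mathrm{dist}((x,x^*,T),\Pi_{\mathrm{nu}}(X))\ge\varepsilon\}.$$ Equivalently, $\eta_{\mathrm{nu}}(X)(\varepsilon)$ is the supremum of those $\eta>0$ such that whenever $T\in\mathcal{L}(X)$ and $(x,x^* )\in\Pi(X)$ satisfy $v(T)=1$ and $|x^*(Tx)|>1-\eta$, there exist $S\in\mathcal{L}(X)$ and $(y,y^* )\in\Pi(X)$ with $v(S)=|y^*(Sy)|=1$, $\|T-S\|<\varepsilon$, $\|x-y\|<\varepsilon$, $\|x^*-y^*\|<\varepsilon$ (the supremum of the empty set being $0$). *)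

(* Defs.v *)
From HB Require Import structures.
From mathcomp Require Import all_boot all_order all_algebra.
From mathcomp Require Import complex.
From mathcomp Require Import all_classical all_reals all_analysis.

Set Implicit Arguments.
Unset Strict Implicit.
Unset Printing Implicit Defensive.

Import Order.TTheory GRing.Theory Num.Theory.
Import numFieldNormedType.Exports.

Local Open Scope classical_set_scope.
Local Open Scope ring_scope.

Variant scalar_kind := RealScalars | ComplexScalars.

Definition scalar_field (R : realType) (k : scalar_kind) : numFieldType :=
  match k with RealScalars => R | ComplexScalars => R[i] end.

Definition scalar_re (R : realType) (k : scalar_kind) :
    scalar_field R k -> R :=
  match k with RealScalars => id | ComplexScalars => @complex.Re R end.

Definition scalar_of_real (R : realType) (k : scalar_kind) :
    R -> scalar_field R k :=
  match k with RealScalars => id | ComplexScalars => real_complex R end.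
Arguments scalar_of_real {R} k.

Section scalars.
Variables (R : realType) (k : scalar_kind).
Local Notation K := (scalar_field R k).
Local Notation "r %:K" := (scalar_of_real k r) (at level 2, format "r %:K").

Lemma scalar_of_realK (r : R) : scalar_re r%:K = r.
Proof. by case: k. Qed.

Lemma scalar_reK (z : K) : 0 <= z -> (scalar_re z)%:K = z.
Proof.
move: z; rewrite /scalar_re /scalar_of_real; case: k => //= -[a b].
by rewrite lecE /= => /andP[/eqP -> _].
Qed.

Lemma scalar_of_realD (r s : R) : (r + s)%:K = r%:K + s%:K.
Proof.
rewrite /scalar_of_real; case: k => //=.
exact: (rmorphD (real_complex R)).
Qed.

Lemma scalar_of_realM (r s : R) : (r * s)%:K = r%:K * s%:K.
Proof.
rewrite /scalar_of_real; case: k => //=.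
exact: (rmorphM (real_complex R)).
Qed.

Lemma scalar_of_real0 : 0%:K = 0 :> K.
Proof. by case: k. Qed.

Lemma scalar_of_real_le (r s : R) : (r%:K <= s%:K :> K) = (r <= s).
Proof.
rewrite /scalar_of_real; case: k => //=.
exact: lecR.
Qed.

End scalars.

(* The library's norm takes its values in the scalar field, [R] or [R[i]];
   [rnorm] is the same norm seen as an element of [R]. *)
Definition rnorm (R : realType) (k : scalar_kind)
    (V : normedModType (scalar_field R k)) (x : V) : R := scalar_re `|x|.

Section rnorm_theory.
Variables (R : realType) (k : scalar_kind).
Local Notation K := (scalar_field R k).
Variable V : normedModType K.
Implicit Types x y : V.

Lemma rnormK x : scalar_of_real k (rnorm x) = `|x|.
Proof. exact: scalar_reK. Qed.

Lemma rnorm_ge0 x : 0 <= rnorm x.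
Proof. by rewrite -(scalar_of_real_le k) rnormK scalar_of_real0. Qed.

Lemma rnorm0 : rnorm (0 : V) = 0.
Proof. by rewrite /rnorm normr0 -(scalar_of_real0 R k) scalar_of_realK. Qed.

Lemma rnorm0_eq0 x : rnorm x = 0 -> x = 0.
Proof.
by move=> x0; apply: normr0_eq0; rewrite -rnormK x0 scalar_of_real0.
Qed.

Lemma rnormD x y : rnorm (x + y) <= rnorm x + rnorm y.
Proof. by rewrite -(scalar_of_real_le k) scalar_of_realD !rnormK ler_normD. Qed.

Lemma rnormZ (a : K) x : rnorm (a *: x) = scalar_re `|a| * rnorm x.
Proof.
rewrite {1}/rnorm normrZ -rnormK -{1}(scalar_reK (normr_ge0 a)).
by rewrite -scalar_of_realM scalar_of_realK.
Qed.

End rnorm_theory.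

Section bounded_operators.
Variables (R : realType) (k : scalar_kind).
Local Notation K := (scalar_field R k).
Variables V W : normedModType K.

Definition bounded_linear (f : V -> W) : Prop :=
  linear f /\ exists M : R, forall x, rnorm (f x) <= M * rnorm x.

Definition bounded_linear_pred : {pred (V -> W)} :=
  [pred f | `[< bounded_linear f >]].

Record bounded_operator := BoundedOperator {
  bounded_operator_fun :> V -> W;
  _ : bounded_operator_fun \in bounded_linear_pred }.

HB.instance Definition _ := [isSub for bounded_operator_fun].
HB.instance Definition _ := [Choice of bounded_operator by <:].

Lemma bounded_linear_submod_closed : submod_closed bounded_linear_pred.
Proof.
split.
  apply/asboolP; split.
    by move=> a u v; rewrite scaler0 addr0.
  by exists 0 => x; rewrite mul0r rnorm0.
move=> a f g => /asboolP[lf [M fM]] /asboolP[lg [N gN]].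
apply/asboolP; split.
  move=> b u v; have E y : (a *: f + g) y = a *: f y + g y by [].
  by rewrite !E lf lg !scalerDr !scalerA mulrC addrACA.
exists (scalar_re `|a| * M + N) => x; rewrite -[X in rnorm X]/(a *: f x + g x).
apply: (le_trans (rnormD _ _)); rewrite rnormZ mulrDl lerD// -mulrA.
by rewrite ler_wpM2l// (rnorm_ge0 (a : K^o)).
Qed.

HB.instance Definition _ := GRing.isSubmodClosed.Build K (V -> W)
  bounded_linear_pred bounded_linear_submod_closed.
HB.instance Definition _ := [SubChoice_isSubLmodule of bounded_operator by <:].

Definition operator_norm (f : bounded_operator) : R :=
  sup [set rnorm (f x) | x in [set x : V | rnorm x <= 1]].

Lemma bounded_operatorP (f : bounded_operator) : bounded_linear f.
Proof. by case: f => f /= /asboolP. Qed.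

Lemma has_sup_operator_norm (f : bounded_operator) :
  has_sup [set rnorm (f x) | x in [set x : V | rnorm x <= 1]].
Proof.
split; first by exists (rnorm (f 0)), 0 => //=; rewrite rnorm0.
have [_ [M fM]] := bounded_operatorP f.
exists `|M| => _ [x /= x1 <-]; apply: (le_trans (fM x)).
apply: (@le_trans _ _ (`|M| * rnorm x)).
  by rewrite ler_wpM2r ?rnorm_ge0 ?ler_norm.
by rewrite -[leRHS]mulr1 ler_wpM2l.
Qed.

Lemma operator_norm_ge0 (f : bounded_operator) : 0 <= operator_norm f.
Proof.
apply: (le_trans (rnorm_ge0 (f 0))).
apply: sup_upper_bound; first exact: has_sup_operator_norm.
by exists 0 => //=; rewrite rnorm0.
Qed.

Lemma operator_norm_le (f : bounded_operator) (x : V) :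
  rnorm (f x) <= operator_norm f * rnorm x.
Proof.
have [lf _] := bounded_operatorP f.
have fZ a y : f (a *: y) = a *: f y.
  have f0 : f 0 = 0.
    by have := lf (-1) 0 0; rewrite scaler0 addr0 scaleN1r addNr.
  by rewrite -[a *: y]addr0 lf f0 addr0.
have [x0|x0] := eqVneq (rnorm x) 0.
  rewrite x0 mulr0 (rnorm0_eq0 x0) -(scale0r (0 : V)) fZ scale0r.
  by rewrite rnorm0.
have xgt0 : 0 < rnorm x by rewrite lt_neqAle eq_sym x0 rnorm_ge0.
pose a := scalar_of_real k (rnorm x)^-1.
have na : scalar_re `|a| = (rnorm x)^-1.
  rewrite ger0_norm ?scalar_of_realK// -(scalar_of_real0 R k).
  by rewrite scalar_of_real_le invr_ge0 rnorm_ge0.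
rewrite -ler_pdivrMr// mulrC -na -rnormZ -fZ.
apply: sup_upper_bound; first exact: has_sup_operator_norm.
by exists (a *: x) => //=; rewrite rnormZ na mulVf.
Qed.

Definition operator_knorm (f : bounded_operator) : K :=
  scalar_of_real k (operator_norm f).

Lemma operator_knormD (f g : bounded_operator) :
  operator_knorm (f + g) <= operator_knorm f + operator_knorm g.
Proof.
rewrite -scalar_of_realD scalar_of_real_le.
apply: ge_sup; first by have [] := has_sup_operator_norm (f + g).
move=> _ [x /= x1 <-]; rewrite -[X in rnorm X]/(f x + g x).
apply: (le_trans (rnormD _ _)); apply: lerD.
  by apply: sup_upper_bound; [exact: has_sup_operator_norm|exists x].
by apply: sup_upper_bound; [exact: has_sup_operator_norm|exists x].
Qed.

Lemma operator_knormZ (a : K) (f : bounded_operator) :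
  operator_knorm (a *: f) = `|a| * operator_knorm f.
Proof.
rewrite -(scalar_reK (normr_ge0 a)) -scalar_of_realM.
have a0 : 0 <= scalar_re `|a| := rnorm_ge0 (a : K^o).
congr scalar_of_real; apply/eqP; rewrite eq_le; apply/andP; split.
  apply: ge_sup; first by have [] := has_sup_operator_norm (a *: f).
  move=> _ [x /= x1 <-]; rewrite -[X in rnorm X]/(a *: f x) rnormZ.
  rewrite ler_wpM2l//.
  by apply: sup_upper_bound; [exact: has_sup_operator_norm|exists x].
have [->|ane0] := eqVneq (scalar_re `|a|) 0.
  by rewrite mul0r operator_norm_ge0.
have apos : 0 < scalar_re `|a| by rewrite lt_neqAle eq_sym ane0.
rewrite mulrC -ler_pdivlMr//.
apply: ge_sup; first by have [] := has_sup_operator_norm f.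
move=> _ [x /= x1 <-]; rewrite ler_pdivlMr// mulrC -rnormZ.
apply: sup_upper_bound; first exact: has_sup_operator_norm.
by exists x.
Qed.

Lemma operator_knorm_eq0 (f : bounded_operator) : operator_knorm f = 0 -> f = 0.
Proof.
rewrite -(scalar_of_real0 R k) => /(congr1 (@scalar_re R k)).
rewrite !scalar_of_realK => f0; apply/val_inj/funext => x /=.
rewrite -[RHS]/(0 : W); apply/rnorm0_eq0/eqP; rewrite eq_le rnorm_ge0 andbT.
by have := operator_norm_le f x; rewrite f0 mul0r.
Qed.

HB.instance Definition _ := Lmodule_isNormed.Build K bounded_operator
  operator_knormD operator_knormZ operator_knorm_eq0.

Lemma rnorm_operatorE (f : bounded_operator) : rnorm f = operator_norm f.
Proof. by rewrite /rnorm /= /Num.norm /= scalar_of_realK. Qed.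

End bounded_operators.

Section numerical_radius.
Variables (R : realType) (k : scalar_kind).
Local Notation K := (scalar_field R k).

Definition dual_space (X : normedModType K) : Type := bounded_operator X K^o.
HB.instance Definition _ (X : normedModType K) :=
  NormedModule.on (dual_space X).

Section bidual.
Variable X : normedModType K.

Lemma evaluation_bounded_linear (x : X) :
  (fun f : dual_space X => f x) \in @bounded_linear_pred R k (dual_space X) K^o.
Proof.
apply/asboolP; split; first by [].
exists (rnorm x) => f; rewrite mulrC rnorm_operatorE.
exact: operator_norm_le.
Qed.

Definition bidual_embedding (x : X) : dual_space (dual_space X) :=
  BoundedOperator (evaluation_bounded_linear x).

Definition reflexive_space : Prop := set_surj setT setT bidual_embedding.

End bidual.

Variable X : normedModType K.

Definition Pi : set (X * dual_space X) :=
  [set p : X * dual_space X |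
    [/\ rnorm p.1 = 1, rnorm p.2 = 1 & p.2 p.1 = 1]].

Definition numerical_value (T : bounded_operator X X)
    (p : X * dual_space X) : R := rnorm (p.2 (T p.1)).

(* The set is bounded by the operator norm of [T]; it is empty, with supremum 0
   by the library's convention, only when X = 0. *)
Definition numerical_radius (T : bounded_operator X X) : R :=
  sup [set numerical_value T p | p in Pi].

Definition BPBp_nu : Prop :=
  forall eps : R, 0 < eps < 1 -> exists2 eta : R, 0 < eta &
  forall (T : bounded_operator X X) (x : X) (xs : dual_space X),
    Pi (x, xs) -> numerical_radius T = 1 -> 1 - eta < numerical_value T (x, xs) ->
  exists (S : bounded_operator X X) (y : X) (ys : dual_space X),
    [/\ Pi (y, ys), numerical_radius S = 1 /\ numerical_value S (y, ys) = 1,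
        rnorm (T - S) < eps, rnorm (x - y) < eps & rnorm (xs - ys) < eps].

Local Notation triple := (X * dual_space X * bounded_operator X X)%type.

Definition Pi_nu : set triple :=
  [set z : triple | [/\ Pi z.1, numerical_radius z.2 = 1
             & numerical_value z.2 z.1 = 1]].

Definition triple_dist (z w : triple) : R :=
  Num.max (Num.max (rnorm (z.1.1 - w.1.1)) (rnorm (z.1.2 - w.1.2)))
          (rnorm (z.2 - w.2)).

Definition dist_to_set (z : triple) (A : set triple) : \bar R :=
  ereal_inf [set (triple_dist z w)%:E | w in A].

(* The infimum of the empty set is +oo, here and in [dist_to_set]; this makes
   [eta_nu eps] the supremum of the admissible eta in [BPBp_nu] at eps. *)
Definition eta_nu (eps : R) : \bar R :=
  ereal_inf [set (1 - numerical_value z.2 z.1)%:E | z in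
    [set z : triple | [/\ Pi z.1, numerical_radius z.2 = 1
                        & (eps%:E <= dist_to_set z Pi_nu)%E]]].

End numerical_radius.

(* Main.v *)
Require Import Defs.
From mathcomp Require Import all_boot all_order all_algebra.
From mathcomp Require Import complex.
From mathcomp Require Import all_classical all_reals all_analysis.

(** The numerical radius does not see the difference between a reflexive space
    and its dual.  Send a triple (x, x^*, T) on X to the triple
    (x^*, J x, T^* ) on X^*, where J is the canonical map of X into its bidual
    and T^* is the adjoint.  Since (J x)(T^* x^* ) = x^*(T x), this map respects
    [numerical_value]; once it is known to be a bijection that respects norms of
    differences, it respects [Pi], [numerical_radius], [Pi_nu] and
    [triple_dist] as well, so the two infima that define [eta_nu] run over the
    same set of numbers ([eta_nu_dual]).  The statement on the property BPBp-nu
    follows because the property says exactly that [eta_nu] is positive on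
    (0, 1) ([BPBp_nuP]).

    Two facts make the map an isometric bijection.  The map J is isometric
    ([rnorm_bidual_embedding]), and this also gives that T and T^* have the
    same norm ([rnorm_adjoint]).  And when J is onto, so is T |-> T^*: the
    operator whose adjoint is a given U is J^-1 o U^* o J ([adjoint_surj]).

    That J is isometric is the Hahn-Banach theorem.  It is proved here by
    working with sublinear functionals defined on the whole space rather than
    with linear functionals on subspaces: by Zorn's lemma there is a minimal
    sublinear functional below a given one, and minimality forces it to be
    real-linear ([minimal_sublinear_real_linear]).  Over the complex numbers a
    real-linear f is the real part of the linear x |-> f x - i f (i x), and the
    latter inherits the bound of f because its values can be rotated onto the
    positive reals ([rnorm_le_of_re]). *)

Set Implicit Arguments.
Unset Strict Implicit.
Unset Printing Implicit Defensive.

Import Order.TTheory GRing.Theory Num.Theory.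
Import numFieldNormedType.Exports.

Local Open Scope classical_set_scope.
Local Open Scope ring_scope.

(** * Sublinear functionals and the Hahn-Banach theorem *)

Section sublinear_functionals.
Variables (R : realType) (k : scalar_kind).
Local Notation K := (scalar_field R k).
Local Notation "r %:K" := (scalar_of_real k r) (at level 2, format "r %:K").
Variable V : lmodType K.
Implicit Types (p q : V -> R) (f : V -> R) (x y a : V).

Lemma scalar_of_real1 : 1%:K = 1 :> K.
Proof. by case: k. Qed.

Definition sublinear p : Prop :=
  (forall x y, p (x + y) <= p x + p y) /\
  (forall (r : R) x, 0 <= r -> p (r%:K *: x) = r * p x).

Definition real_linear f : Prop :=
  (forall x y, f (x + y) = f x + f y) /\
  (forall (r : R) x, f (r%:K *: x) = r * f x).

Lemma sublinear0 p : sublinear p -> p 0 = 0.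
Proof. by case=> _ /(_ 0 0 (lexx _)); rewrite scaler0 mul0r. Qed.

Lemma sublinear_ge p x : sublinear p -> - p (- x) <= p x.
Proof.
move=> sp; have [pD _] := sp.
by rewrite lerNl -subr_ge0 opprK addrC -(sublinear0 sp) -(subrr x) pD.
Qed.

(** Infima of sublinear functionals are not sublinear in general; a weak form of
    directedness of the family is enough.  Both infima formed below, over the
    half-line in [slide] and over a chain in [minimal_sublinear], have it. *)
Lemma sublinear_inf (I : Type) (D : set I) (F : I -> V -> R) (b : V -> R) :
  D !=set0 -> (forall i x, D i -> b x <= F i x) ->
  (forall i, D i -> F i 0 = 0) ->
  (forall i j x y, D i -> D j ->
     exists2 l, D l & F l (x + y) <= F i x + F j y) ->
  (forall i (r : R) x, D i -> 0 < r ->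
     exists2 l, D l & F l (r%:K *: x) <= r * F i x) ->
  sublinear (fun x => inf [set F i x | i in D]).
Proof.
move=> [i0 Di0] bF F0 FD FZ; pose g x := inf [set F i x | i in D].
have gF i x : D i -> g x <= F i x.
  move=> Di; apply: ge_inf; last by exists i.
  by exists (b x) => _ [j Dj <-]; apply: bF.
have g_ge c x : (forall i, D i -> c <= F i x) -> c <= g x.
  move=> cF; apply: lb_le_inf; first by exists (F i0 x), i0.
  by move=> _ [j Dj <-]; apply: cF.
have g0 : g 0 = 0.
  apply/le_anti/andP; split; first by rewrite -(F0 _ Di0) gF.
  by apply: (g_ge) => i Di; rewrite F0.
have gZ_le r x : 0 < r -> g (r%:K *: x) <= r * g x.
  move=> r0; rewrite mulrC -ler_pdivrMr//; apply: (g_ge) => i Di.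
  rewrite ler_pdivrMr// mulrC; have [l Dl Fl] := FZ i r x Di r0.
  exact: le_trans (gF _ _ Dl) Fl.
split=> [x y|r x].
  rewrite -/(g _) -/(g x) -/(g y) -lerBlDl; apply: (g_ge) => j Dj.
  rewrite lerBlDl -lerBlDr; apply: (g_ge) => i Di; rewrite lerBlDr.
  have [l Dl Fl] := FD i j x y Di Dj.
  exact: le_trans (gF _ _ Dl) Fl.
rewrite le_eqVlt => /predU1P[<-|r0].
  by rewrite scalar_of_real0 scale0r mul0r -/(g 0) g0.
apply/le_anti/andP; split; first exact: gZ_le.
rewrite -/(g x) -/(g _) mulrC -ler_pdivlMr// mulrC.
have {1}-> : x = (r^-1)%:K *: (r%:K *: x).
  by rewrite scalerA -scalar_of_realM mulVf ?gt_eqF// scalar_of_real1 scale1r.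
by rewrite gZ_le// invr_gt0.
Qed.

(** This is the largest sublinear functional q below the sublinear p such that
    q (- a) <= - p a: indeed q x <= q (x + t a) + t q (- a). *)
Definition slide p a x : R :=
  inf [set p (x + t%:K *: a) - t * p a | t in [set t : R | 0 <= t]].

Lemma slide_lbound p a x (t : R) :
  sublinear p -> 0 <= t -> - p (- x) <= p (x + t%:K *: a) - t * p a.
Proof.
move=> [pD pZ] t0; rewrite lerNl opprB lerBlDl -pZ//.
by apply: le_trans (pD _ _); rewrite addrAC subrr add0r.
Qed.

Lemma slide_le p a x (t : R) :
  sublinear p -> 0 <= t -> slide p a x <= p (x + t%:K *: a) - t * p a.
Proof.
move=> sp t0; apply: ge_inf; last by exists t.
by exists (- p (- x)) => _ [s /= s0 <-]; apply: slide_lbound.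
Qed.

Lemma slide_le_self p a x : sublinear p -> slide p a x <= p x.
Proof.
move=> /slide_le => /(_ a x 0 (lexx _)).
by rewrite scalar_of_real0 scale0r addr0 mul0r subr0.
Qed.

Lemma slide_opp p a : sublinear p -> slide p a (- a) <= - p a.
Proof.
move=> sp; have := slide_le a (- a) sp ler01.
by rewrite scalar_of_real1 scale1r addNr mul1r (sublinear0 sp) sub0r.
Qed.

Lemma sublinear_slide p a : sublinear p -> sublinear (slide p a).
Proof.
move=> sp; have [pD pZ] := sp.
apply: (@sublinear_inf R [set t | 0 <= t]
  (fun t x => p (x + t%:K *: a) - t * p a) (fun x => - p (- x))).
- by exists 0 => /=.
- by move=> t x; apply: slide_lbound.
- by move=> t t0; rewrite add0r pZ// subrr.
- move=> s t x y /= s0 t0; exists (s + t); first exact: addr_ge0.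
  by rewrite addrACA -opprD -mulrDl lerD2r scalar_of_realD scalerDl addrACA pD.
- move=> t r x /= t0 r0; exists (r * t); first by rewrite mulr_ge0// ltW.
  rewrite mulrBr mulrA lerD2r scalar_of_realM -scalerA -scalerDr pZ//.
  exact: ltW.
Qed.

(** Zorn's lemma for the reverse pointwise order.  A chain is bounded by its
    pointwise infimum, which is finite because - p (- x) <= q x for every
    sublinear q below p. *)
Lemma minimal_sublinear p : sublinear p ->
  exists q, [/\ sublinear q, forall x, q x <= p x &
    forall q', sublinear q' -> (forall x, q' x <= q x) ->
      forall x, q x <= q' x].
Proof.
move=> sp; pose T := {q : V -> R | sublinear q /\ forall x, q x <= p x}.
pose le_rev (q q' : T) := `[< forall x, sval q' x <= sval q x >].
pose p0 : T := exist _ p (conj sp (fun=> lexx _)).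
have [||A totA|q qmin] := ZL_preorder p0 (R := le_rev).
- by move=> q; apply/asboolP.
- move=> q1 q2 q3 /asboolP q12 /asboolP q23; apply/asboolP => x.
  exact: le_trans (q23 x) (q12 x).
- have [/eqP ->|/set0P A0] := boolP (A == set0); first by exists p0.
  pose g x := inf [set sval q x | q in A].
  have Alb (q : T) x : A q -> - p (- x) <= sval q x.
    case: q => q [/= sq qp] _; apply: le_trans (sublinear_ge x sq).
    by rewrite lerN2.
  have gA (q : T) x : A q -> g x <= sval q x.
    move=> Aq; apply: ge_inf; last by exists q.
    by exists (- p (- x)) => _ [q' Aq' <-]; apply: Alb.
  have sg : sublinear g.
    apply: (sublinear_inf A0 Alb).
    + by move=> [q [sq qp]] _ /=; apply: sublinear0.
    + move=> q q' x y Aq Aq'.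
      have [/asboolP qq'|/asboolP qq'] := totA _ _ Aq Aq'.
        exists q' => //; case: q' => q' [[q'D q'Z] q'p] /= in Aq' qq' *.
        by apply: (le_trans (q'D _ _)); rewrite lerD2r.
      exists q => //; case: q => q [[qD qZ] qp] /= in Aq qq' *.
      by apply: (le_trans (qD _ _)); rewrite lerD2l.
    + move=> q r x Aq r0; exists q => //.
      by case: q {Aq} => q [[qD qZ] qp] /=; rewrite qZ// ltW.
  have gp x : g x <= p x.
    have [q Aq] := A0; apply: le_trans (gA _ _ Aq) _.
    by case: q {Aq} => q [] /=.
  by exists (exist _ g (conj sg gp)) => q Aq; apply/asboolP => x; apply: gA.
case: q qmin => q [sq qp] qmin; exists q; split=> // q' sq' q'q.
have q'p x : q' x <= p x := le_trans (q'q x) (qp x).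
pose q'T : T := exist _ q' (conj sq' q'p).
have /asboolP : le_rev q'T (exist _ q (conj sq qp)).
  by apply: qmin; apply/asboolP.
by [].
Qed.

(** For every x the functional [slide q x] is sublinear and below q, hence equal
    to q by minimality, so q (- x) <= - q x.  Thus q is odd, and an odd
    sublinear functional is real-linear. *)
Lemma minimal_sublinear_real_linear q : sublinear q ->
  (forall q', sublinear q' -> (forall x, q' x <= q x) ->
     forall x, q x <= q' x) -> real_linear q.
Proof.
move=> sq qmin; have [qD qZ] := sq.
have qN x : q (- x) = - q x.
  apply/le_anti/andP; split; last first.
    by have := sublinear_ge (- x) sq; rewrite opprK.
  apply: le_trans (slide_opp x sq); apply: qmin; first exact: sublinear_slide.
  by move=> y; apply: slide_le_self.
split=> [x y|r x].
  apply/le_anti; rewrite qD /= -lerN2 -qN opprD.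
  by apply: (le_trans (qD _ _)); rewrite !qN opprD.
have [r0|r0] := leP 0 r; first exact: qZ.
apply: oppr_inj; rewrite -qN -mulNr -qZ; last by rewrite oppr_ge0 ltW.
congr q; rewrite -scaleNr; congr (_ *: _); apply/eqP; rewrite eq_sym -addr_eq0.
by rewrite -scalar_of_realD addNr scalar_of_real0.
Qed.

(** A real-linear functional below [slide p a], instead of merely below p, must
    touch p at a. *)
Lemma Hahn_Banach_support p a : sublinear p ->
  exists f, [/\ real_linear f, forall x, f x <= p x & f a = p a].
Proof.
move=> sp; have [f [sf fp fmin]] := minimal_sublinear (sublinear_slide a sp).
have fle x : f x <= p x by apply: le_trans (fp x) (slide_le_self _ _ sp).
have lf := minimal_sublinear_real_linear sf fmin.
exists f; split=> //; apply/le_anti; rewrite fle /= -lerN2.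
apply: le_trans (slide_opp a sp); apply: le_trans (fp _).
by have := sublinear_ge (- a) sf; rewrite opprK.
Qed.

End sublinear_functionals.

(** * From real-linear functionals to the dual space *)

Lemma complex_re_le_norm (R : rcfType) (z : R[i]) :
  complex.Re z <= complex.Re `|z|.
Proof.
rewrite normc_def /=; apply: (le_trans (ler_norm _)).
by rewrite -sqrtr_sqr ler_wsqrtr// lerDl sqr_ge0.
Qed.

Lemma scalar_re_le_norm (R : realType) (k : scalar_kind)
  (z : scalar_field R k) : scalar_re z <= scalar_re `|z|.
Proof.
move: z; case: k => z; [exact: ler_norm | exact: complex_re_le_norm].
Qed.

(** In the complex case the imaginary part is forced:
    Im (F x) = - Re (F (i x)). *)
Lemma real_linear_re (R : realType) (k : scalar_kind)
    (V : lmodType (scalar_field R k)) (f : V -> R) : real_linear f ->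
  exists F : V -> (scalar_field R k)^o,
    linear F /\ forall x, scalar_re (F x) = f x.
Proof.
case: k V f => /= V f [fD fZ].
  by exists f; split=> // a x y; rewrite fD fZ.
have fN x : f (- x) = - f x.
  have := fZ (-1) x; rewrite mulN1r /= => <-; congr f.
  by rewrite -scaleN1r; congr (_ *: _); rewrite rmorphN1.
exists (fun x => f x -i* f ('i%C *: x))%C; split=> // a x y.
have aE : a = (complex.Re a)%:C%C + 'i%C * (complex.Im a)%:C%C.
  exact: complexE.
have fa z : f (a *: z) = complex.Re a * f z + complex.Im a * f ('i%C *: z).
  rewrite {1}aE scalerDl fD (mulrC 'i%C) -scalerA.
  by congr (_ + _); exact: fZ.
have fia z : f ('i%C *: (a *: z)) =
    complex.Re a * f ('i%C *: z) - complex.Im a * f z.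
  rewrite scalerA mulrC -scalerA fa; congr (_ + _).
  by rewrite scalerA -expr2 sqr_i scaleN1r fN mulrN.
apply/eqP; rewrite eq_complex /=; apply/andP; split; apply/eqP.
  by rewrite fD fa; case: a {aE fa fia} => a b /=; rewrite mulrN opprK.
rewrite scalerDr fD fia; case: a {aE fa fia} => a b /=.
by rewrite mulrN !opprD opprK.
Qed.

Section dual_norm.
Variables (R : realType) (k : scalar_kind).
Local Notation K := (scalar_field R k).
Variables V W : normedModType K.

Lemma sublinear_rnorm : sublinear (@rnorm R k V).
Proof.
split=> [x y|r x r0]; first exact: rnormD.
rewrite rnormZ ger0_norm ?scalar_of_realK// -(scalar_of_real0 R k).
by rewrite scalar_of_real_le.
Qed.

Lemma operator_norm_le_bound (f : bounded_operator V W) (M : R) : 0 <= M ->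
  (forall x, rnorm (f x) <= M * rnorm x) -> rnorm f <= M.
Proof.
move=> M0 fM; rewrite rnorm_operatorE; apply: ge_sup.
  by have [] := has_sup_operator_norm f.
move=> _ [x /= x1 <-]; apply: le_trans (fM x) _.
by rewrite -[leRHS]mulr1 ler_wpM2l.
Qed.

Lemma rnorm_le_operator (f : bounded_operator V W) (x : V) :
  rnorm (f x) <= rnorm f * rnorm x.
Proof. by rewrite rnorm_operatorE operator_norm_le. Qed.


(** Multiplying x by a scalar c of modulus 1 such that c (F x) = |F x| changes
    neither side of the conclusion and makes F x equal to its real part. *)
Lemma rnorm_le_of_re (F : V -> K^o) : linear F ->
  (forall x, scalar_re (F x) <= rnorm x) -> forall x, rnorm (F x) <= rnorm x.
Proof.
move=> lF FM x; have [F0|F0] := eqVneq (F x) 0.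
  by rewrite F0 rnorm0 rnorm_ge0.
have FZ a y : F (a *: y) = a * F y.
  have F00 : F 0 = 0.
    by have := lF (-1) 0 0; rewrite scaler0 addr0 scaleN1r addNr.
  by rewrite -[a *: y]addr0 lF F00 addr0.
pose c : K := `|F x| / F x.
have c1 : `|c| = 1.
  by rewrite normrM normrV ?unitfE// normr_id divff// normr_eq0.
have := FM (c *: x); rewrite FZ /c divfK// rnormZ -/c c1.
by rewrite -(scalar_of_real1 R k) scalar_of_realK mul1r.
Qed.

End dual_norm.

(** * The canonical embedding and adjoint operators *)

Section bidual_and_adjoint.
Variables (R : realType) (k : scalar_kind).
Local Notation K := (scalar_field R k).

Lemma exists_norming_functional (V : normedModType K) (a : V) :
  exists f : dual_space V, rnorm f <= 1 /\ rnorm a <= rnorm (f a).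
Proof.
have [g [lg gle ga]] := Hahn_Banach_support a (sublinear_rnorm V).
have [F [lF Fg]] := real_linear_re lg.
have F1 x : rnorm (F x) <= rnorm x.
  by apply: rnorm_le_of_re => // y; rewrite Fg.
have Fbl : F \in @bounded_linear_pred R k V K^o.
  by apply/asboolP; split=> //; exists 1 => x; rewrite mul1r.
exists (BoundedOperator Fbl); split.
  by apply: operator_norm_le_bound => // x; rewrite mul1r.
by rewrite -ga -Fg; exact: scalar_re_le_norm.
Qed.

Lemma rnorm_bidual_embedding (V : normedModType K) (x : V) :
  rnorm (bidual_embedding x) = rnorm x.
Proof.
apply/le_anti/andP; split.
  apply: operator_norm_le_bound; first exact: rnorm_ge0.
  by move=> f; rewrite mulrC; exact: (rnorm_le_operator f x).
have [f [f1 /le_trans]] := exists_norming_functional x; apply.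
apply: (le_trans (rnorm_le_operator (bidual_embedding x) f)).
by rewrite -[leRHS]mulr1 ler_wpM2l ?rnorm_ge0.
Qed.

Lemma bidual_embeddingB (V : normedModType K) (x y : V) :
  bidual_embedding (x - y) = bidual_embedding x - bidual_embedding y.
Proof.
apply/val_inj/funext => f /=; have [lf _] := bounded_operatorP f.
by rewrite addrC -scaleN1r lf scaleN1r addrC.
Qed.

Lemma bidual_embedding_inj (V : normedModType K) :
  injective (@bidual_embedding R k V).
Proof.
move=> x y /eqP; rewrite -subr_eq0 -bidual_embeddingB => /eqP xy0.
apply/eqP; rewrite -subr_eq0; apply/eqP/rnorm0_eq0.
by rewrite -rnorm_bidual_embedding xy0 rnorm0.
Qed.

Section adjoint.
Variables V W : normedModType K.

Lemma adjoint_fun_bounded_linear (T : bounded_operator V W) (f : dual_space W) :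
  (fun x => f (T x)) \in @bounded_linear_pred R k V K^o.
Proof.
have [[lT _] [lf _]] := (bounded_operatorP T, bounded_operatorP f).
apply/asboolP; split; first by move=> a x y; rewrite lT lf.
exists (rnorm f * rnorm T) => x.
apply: (le_trans (rnorm_le_operator _ _)); rewrite -mulrA.
by rewrite ler_wpM2l ?rnorm_ge0 ?rnorm_le_operator.
Qed.

Definition adjoint_fun (T : bounded_operator V W) (f : dual_space W) :
  dual_space V := BoundedOperator (adjoint_fun_bounded_linear T f).

Lemma rnorm_adjoint_fun T f : rnorm (adjoint_fun T f) <= rnorm T * rnorm f.
Proof.
apply: operator_norm_le_bound; first by rewrite mulr_ge0 ?rnorm_ge0.
move=> x; apply: (le_trans (rnorm_le_operator f (T x))).
by rewrite [rnorm T * _]mulrC -mulrA ler_wpM2l ?rnorm_ge0 ?rnorm_le_operator.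
Qed.

Lemma adjoint_bounded_linear (T : bounded_operator V W) :
  adjoint_fun T \in @bounded_linear_pred R k (dual_space W) (dual_space V).
Proof.
apply/asboolP; split; first by move=> a f g; apply/val_inj/funext.
by exists (rnorm T) => f; exact: rnorm_adjoint_fun.
Qed.

Definition adjoint (T : bounded_operator V W) :
    bounded_operator (dual_space W) (dual_space V) :=
  BoundedOperator (adjoint_bounded_linear T).

(** The norm of T x is that of [bidual_embedding (T x)], whose value at f is
    that of [adjoint T f] at x. *)
Lemma rnorm_adjoint T : rnorm (adjoint T) = rnorm T.
Proof.
apply/le_anti/andP; split.
  apply: operator_norm_le_bound; first exact: rnorm_ge0.
  by move=> f; apply: rnorm_adjoint_fun.
apply: operator_norm_le_bound; first exact: rnorm_ge0.
move=> x; rewrite -rnorm_bidual_embedding.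
apply: operator_norm_le_bound; first by rewrite mulr_ge0 ?rnorm_ge0.
move=> f; apply: (le_trans (rnorm_le_operator (adjoint T f) x)).
by rewrite mulrAC ler_wpM2r ?rnorm_ge0 ?rnorm_le_operator.
Qed.

Lemma adjointB T S : adjoint (T - S) = adjoint T - adjoint S.
Proof.
apply/val_inj/funext => f; apply/val_inj/funext => x /=.
have [lf _] := bounded_operatorP f.
rewrite -[LHS]/(f (T x - S x)) -[RHS]/(f (T x) - f (S x)).
by rewrite addrC -scaleN1r lf scaleN1r addrC.
Qed.

End adjoint.

(** The operator T is chosen pointwise with J (T x) = U^* (J x), where J is the
    canonical embedding; since J is
    injective and isometric, T is linear and bounded like U^*. *)
Lemma adjoint_surj (V W : normedModType K) (hW : reflexive_space W)
    (U : bounded_operator (dual_space W) (dual_space V)) :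
  exists T : bounded_operator V W, adjoint T = U.
Proof.
have jW (x : V) :
    exists y : W, bidual_embedding y = adjoint U (bidual_embedding x).
  have [y _ yE] : range (@bidual_embedding R k W)
      (adjoint U (bidual_embedding x)).
    exact: hW.
  by exists y.
have [T TE] := choice jW.
have TU (f : dual_space W) (x : V) : f (T x) = U f x.
  exact: (congr1 (fun z : dual_space (dual_space W) => z f) (TE x)).
have Tbl : T \in @bounded_linear_pred R k V W.
  apply/asboolP; split=> [a x y|].
    apply: bidual_embedding_inj; apply/val_inj/funext => f /=.
    have [lf _] := bounded_operatorP f.
    have [lUf _] := bounded_operatorP (U f).
    by rewrite lf !TU lUf.
  exists (rnorm U) => x; rewrite -rnorm_bidual_embedding TE.
  apply: (le_trans (rnorm_le_operator _ _)).
  by rewrite rnorm_adjoint rnorm_bidual_embedding.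
exists (BoundedOperator Tbl).
by apply/val_inj/funext => f; apply/val_inj/funext => x /=; rewrite TU.
Qed.

End bidual_and_adjoint.

(** * The modulus and the property BPBp-nu *)

Section numerical_radius_modulus.
Variables (R : realType) (k : scalar_kind).
Local Notation K := (scalar_field R k).
Local Notation triple X := (X * dual_space X * bounded_operator X X)%type.

Lemma dist_to_set_lt (X : normedModType K) (z : triple X) A (eps : R) :
  ~ (eps%:E <= dist_to_set z A)%E <-> exists2 w, A w & triple_dist z w < eps.
Proof.
split=> [/negP|[w Aw zw] /ereal_infP]; last first.
  by move=> /(_ _ (imageP _ Aw)); rewrite lee_fin leNgt zw.
by rewrite -ltNge => /ereal_inf_lt[_ [w Aw <-]]; rewrite lte_fin; exists w.
Qed.

(** Any admissible eta at eps is a lower bound for the values of which [eta_nu]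
    is the infimum, and any positive real number that does not exceed [eta_nu]
    is admissible. *)
Lemma BPBp_nuP (X : normedModType K) :
  BPBp_nu X <-> forall eps : R, 0 < eps < 1 -> (0 < eta_nu X eps)%E.
Proof.
split=> [bpb eps /bpb[eta eta0 bpb_eta]|eta_gt0 eps /eta_gt0 eta_pos].
  have /lt_le_trans -> // : (0 < eta%:E)%E by rewrite lte_fin.
  apply/ereal_infP => _ [[[x xs] T] /= [xP T1 far] <-].
  rewrite lee_fin leNgt; apply/negP; rewrite ltrBlDr -ltrBlDl => near.
  have [S [y [ys [yP [S1 ySy] TS xy xsys]]]] := bpb_eta T x xs xP T1 near.
  have /dist_to_set_lt : exists2 w, Pi_nu w & triple_dist (x, xs, T) w < eps.
    by exists (y, ys, S) => //; rewrite /triple_dist !gt_max xy xsys.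
  exact.
have [eta eta0 eta_le] : exists2 eta : R, 0 < eta & (eta%:E <= eta_nu X eps)%E.
  case: (eta_nu X eps) eta_pos => [r| |//]; first by rewrite lte_fin; exists r.
  (* An infinite modulus is an infimum over the empty set. *)
  by exists 1 => //; rewrite leey.
exists eta => // T x xs xP T1 near.
have /dist_to_set_lt[[[y ys] S] [/= yP S1 ySy]] :
    ~ (eps%:E <= dist_to_set (x, xs, T) (@Pi_nu R k X))%E.
  move=> far; have /ereal_infP := eta_le.
  move=> /(_ (1 - numerical_value T (x, xs))%:E) H.
  have /H : [set (1 - numerical_value z.2 z.1)%:E | z in
    [set z : triple X | [/\ Pi z.1, numerical_radius z.2 = 1
      & (eps%:E <= dist_to_set z (@Pi_nu R k X))%E]]]
      (1 - numerical_value T (x, xs))%:E by exists (x, xs, T).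
  by rewrite lee_fin leNgt ltrBlDr -ltrBlDl near.
rewrite /triple_dist !gt_max /= => /andP[/andP[xy xsys] TS].
by exists S, y, ys; split.
Qed.

End numerical_radius_modulus.

(** * Transfer to the dual of a reflexive space *)

Section duality.
Variables (R : realType) (k : scalar_kind).
Local Notation K := (scalar_field R k).
Variable X : normedModType K.
Hypothesis hX : reflexive_space X.
Local Notation triple X := (X * dual_space X * bounded_operator X X)%type.

Definition dual_pair (p : X * dual_space X) :
  dual_space X * dual_space (dual_space X) := (p.2, bidual_embedding p.1).

Definition dual_triple (z : triple X) : triple (dual_space X) :=
  (dual_pair z.1, adjoint z.2).

Lemma dual_pair_surj p' : exists p, dual_pair p = p'.
Proof.
case: p' => f phi.
have [x _ <-] : range (@bidual_embedding R k X) phi by exact: hX.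
by exists (x, f).
Qed.

Lemma dual_triple_surj z' : exists z, dual_triple z = z'.
Proof.
case: z' => p' U; have [p <-] := dual_pair_surj p'.
by have [T <-] := adjoint_surj hX U; exists (p, T).
Qed.

Lemma Pi_dual_pair p : Pi (dual_pair p) <-> Pi p.
Proof.
by split=> -[]; rewrite /= ?rnorm_bidual_embedding; split;
  rewrite //= rnorm_bidual_embedding.
Qed.

Lemma numerical_value_adjoint (T : bounded_operator X X) p :
  numerical_value (adjoint T) (dual_pair p) = numerical_value T p.
Proof. by []. Qed.

Lemma numerical_radius_adjoint (T : bounded_operator X X) :
  numerical_radius (adjoint T) = numerical_radius T.
Proof.
congr sup; apply/seteqP; split=> [_ [p' + <-]|_ [p pP <-]].
  have [p <-] := dual_pair_surj p' => /Pi_dual_pair pP.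
  by exists p.
by exists (dual_pair p) => //; apply/Pi_dual_pair.
Qed.

Lemma triple_dist_dual z w :
  triple_dist (dual_triple z) (dual_triple w) = triple_dist z w.
Proof.
rewrite /triple_dist /= -adjointB rnorm_adjoint -bidual_embeddingB.
by rewrite rnorm_bidual_embedding [X in Num.max X _]maxC.
Qed.

Lemma Pi_nu_dual z : Pi_nu (dual_triple z) <-> Pi_nu z.
Proof.
rewrite /Pi_nu /= numerical_radius_adjoint numerical_value_adjoint.
by split=> -[/Pi_dual_pair].
Qed.

Lemma dist_to_Pi_nu_dual z :
  dist_to_set (dual_triple z) (@Pi_nu R k (dual_space X)) =
  dist_to_set z (@Pi_nu R k X).
Proof.
congr ereal_inf; apply/seteqP; split=> [_ [w' + <-]|_ [w wP <-]].
  have [w <-] := dual_triple_surj w' => /Pi_nu_dual wP.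
  by exists w => //; rewrite triple_dist_dual.
by exists (dual_triple w); [apply/Pi_nu_dual|rewrite triple_dist_dual].
Qed.

Lemma eta_nu_dual eps : eta_nu X eps = eta_nu (dual_space X) eps.
Proof.
congr ereal_inf; apply/seteqP; split=> _ [z + <-].
  move=> [zP z1 far]; exists (dual_triple z) => //; split.
  - exact/Pi_dual_pair.
  - by rewrite numerical_radius_adjoint.
  - by rewrite dist_to_Pi_nu_dual.
have [{}z <-] := dual_triple_surj z.
move=> [/Pi_dual_pair zP]; rewrite numerical_radius_adjoint dist_to_Pi_nu_dual.
by exists z.
Qed.

End duality.

Theorem proposition2p3 (R : realType) (k : scalar_kind)
    (X : completeNormedModType (scalar_field R k)) (hX : reflexive_space X) :
  (forall eps : R, 0 < eps < 1 -> eta_nu X eps = eta_nu (dual_space X) eps) /\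
  (BPBp_nu X <-> BPBp_nu (dual_space X)).
Proof.
split=> [eps _|]; first exact: eta_nu_dual.
by split=> /BPBp_nuP eta_gt0; apply/BPBp_nuP => eps /eta_gt0;
  rewrite (eta_nu_dual hX).
Qed.
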